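(* Let $0<\varepsilon<1$, fix an instance, an optimal schedule $\mathrm{OPT}$ for the total flow time objective, and a time $t$. For all times $t'\le t$, $$\mathrm{vol}_{B(t')}(t')\ \ge\ \mathrm{vol}^*_{\mathrm{OPT}(t,t')}(t').$$ Here $\mathrm{OPT}(t,t')$ is the set of jobs active in the optimal schedule both at time $t$ and at time $t'$, $B(t')$ is the set of the $\lceil 1/\varepsilon\rceil\cdot|\mathrm{OPT}(t,t')|$ active jobs with largest remaining processing time in SLF's schedule at time $t'$, and $\mathrm{vol}_Q(t')$, $\mathrm{vol}^*_Q(t')$ denote the total remaining processing time at time $t'$ of the jobs in $Q$ in the schedule of SLF and in the optimal schedule, respectively.
   Context: **Problem.** An instance is a finite set of jobs. Job $j$ has a release (arrival) time $\ge 0$ and a processing time $p_j>0$. A single machine of unit speed processes the jobs; preemption is allowed at no cost, and the machine may be time-shared (job rates are nonnegative and sum to at most $1$). A job may only be processed after its release and completes when it has received $p_j$ units of processing. A job is active at time $s$ in a schedule if it has been released (release time at most $s$) and is not finished at time $s$. The flow time of a job is its completion time minus its release time; an optimal schedule (computed offline) minimizes the sum of the flow times of all jobs. **Algorithm SLF (Shortest Lower-Bound First).** At time $s$, in the schedule of SLF, let $e_j(s)$ be the amount of processing job $j$ has received up to time $s$ and $r_j(s)=p_j-e_j(s)$ its remaining processing time. An active job $j$ is *known* at time $s$ if $r_j(s)\le \varepsilon p_j$ and *unknown* otherwise; $K(s)$ and $U(s)$ denote the sets of known and unknown active jobs. The estimate of an active job is $\eta_j(s)=\frac{\varepsilon}{1-\varepsilon}e_j(s)$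 if $j\in U(s)$ and $\eta_j(s)=r_j(s)$ if $j\in K(s)$. At each time $s$ with at least one active job, SLF does the following, where a minimum over the empty set is $+\infty$: 1. If $\min_{j\in K(s)}\eta_j(s)\le\min_{j\in U(s)}\eta_j(s)$, it processes an arbitrary known job with minimum $\eta_j(s)$. 2. Otherwise, it processes all unknown jobs with minimum $\eta_j(s)$ in parallel at an equal rate (Round-Robin with infinitesimally small steps). **Notation.** $\mathrm{SLF}(s)$ and $\mathrm{OPT}(s)$ are the sets of jobs active at time $s$ in SLF's and in the optimal schedule; $\mathrm{OPT}(t,t')=\mathrm{OPT}(t)\cap\mathrm{OPT}(t')$. $r^*_j(s)$ is the remaining processing time of $j$ at time $s$ in the optimal schedule; $\mathrm{vol}_Q(s)=\sum_{j\in Q}r_j(s)$ and $\mathrm{vol}^*_Q(s)=\sum_{j\in Q}r^*_j(s)$. If SLF has fewer than $\lceil 1/\varepsilon\rceil\cdot|\mathrm{OPT}(t,t')|$ active jobs at time $t'$, then $B(t')=\mathrm{SLF}(t')$; ties in the choice of $B(t')$ are broken arbitrarily. *)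

(* Defs.v *)
From HB Require Import structures.
From mathcomp Require Import all_boot all_order all_algebra.
From mathcomp Require Import all_classical all_reals all_analysis.

Set Implicit Arguments.
Unset Strict Implicit.
Unset Printing Implicit Defensive.

Import Order.TTheory GRing.Theory Num.Theory.

Local Open Scope ring_scope.

Record instance (R : realType) := Instance {
  job : finType;
  release : job -> R;
  proc : job -> R;
  release_ge0 : forall j, 0 <= release j;
  proc_gt0 : forall j, 0 < proc j }.

                                                                            
                                                                            
                                                                 
Definition schedule (R : realType) (I : instance R) := job I -> R -> R.

Section Schedules.
Variables (R : realType) (I : instance R).
Implicit Types (x y : schedule I) (j : job I) (s : R).

Definition work x j s : R :=
  \int[lebesgue_measure]_(u in `[0, s]%classic) x j u.

Definition remaining x j s : R := proc j - work x j s.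

Definition active x s : {set job I} :=
  [set j | (release j <= s) && (0 < remaining x j s)].

Record feasible x : Prop := Feasible {
  feasible_measurable : forall j, measurable_fun [set: R]%classic (x j);
  feasible_ge0 : forall j s, 0 <= x j s;
  feasible_sum_le1 : forall s, \sum_j x j s <= 1;
  feasible_active : forall j s, j \notin active x s -> x j s = 0 }.

                                                                  
Definition completion x j : \bar R :=
  ereal_inf [set s%:E | s in [set s | remaining x j s <= 0]]%classic.

Definition total_flow x : \bar R :=
  (\sum_j (completion x j - (release j)%:E))%E.

Definition optimal y : Prop :=
  feasible y /\ forall x, feasible x -> (total_flow y <= total_flow x)%E.

Definition total_remaining x (Q : {set job I}) s : R :=
  \sum_(j in Q) remaining x j s.

Section SLF.
Variable eps : R.

Definition known x s : {set job I} :=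
  [set j in active x s | remaining x j s <= eps * proc j].

Definition unknown x s : {set job I} := active x s :\: known x s.

Definition estimate x j s : R :=
  if j \in known x s then remaining x j s
  else eps / (1 - eps) * work x j s.

Definition min_estimate x (Q : {set job I}) s : \bar R :=
  \big[Order.min/+oo%E]_(j in Q) (estimate x j s)%:E.

Definition min_unknown x s : {set job I} :=
  [set j in unknown x s |
    (estimate x j s)%:E == min_estimate x (unknown x s) s].

Definition slf_rule x s : Prop :=
  if (min_estimate x (known x s) s <= min_estimate x (unknown x s) s)%E
  then exists j, [/\ j \in known x s,
         (estimate x j s)%:E = min_estimate x (known x s) s &
         forall i, x i s = if i == j then 1 else 0]
  else forall i, x i s =
         if i \in min_unknown x s then (#|min_unknown x s|%:R)^-1 else 0.

Definition is_SLF x : Prop :=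
  feasible x /\ forall s j, j \in active x s -> slf_rule x s.

End SLF.

                                                                           
                                                                          
                                                                
Definition largest_remaining x s (k : nat) (B : {set job I}) : Prop :=
  [/\ B \subset active x s,
      #|B| = minn k #|active x s| &
      forall i j, i \in B -> j \in active x s :\: B ->
        remaining x j s <= remaining x i s].

End Schedules.

(* Main.v *)
(** Attach to a job [j] and a level [th >= 0] the potential
    [phi th j = min ((r_j - th)^+, (p_j - th / eps)^+)]: it can only drop while
    [j] is processed with an estimate above [th], and it equals [r_j - th] as soon as
    the estimate of [j] is at least [th].  The invariant, for all [th >= 0] at once, is
      [vol*_O <= sum_j phi th j + C th |O|]   with [C >= 1 / eps],
    where [O] is restricted to the released jobs.  Taking for [th] the largest remaining
    time outside [B] turns it into the claim, by duality with the sum of the largest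
    remaining times.

    The invariant is propagated by induction on time.  An arrival of size [p] is paid for
    by [(p - th / eps)^+ + C th >= p].  Between arrivals, if at most [C |O|] jobs are
    active, then all levels below the current estimate follow from work conservation: an
    optimal schedule has done as much work as SLF, as otherwise some job could
    be given idle capacity and finish earlier.  If more jobs are active, lowering
    the level below the current minimal estimate only increases the slack, so the level
    may be taken at this estimate.  When unknown jobs are processed, the minimal
    estimate increases and no potential at a level above it drops.  When known jobs are
    processed, only a single one is, and the others already number at least [C |O|]. *)

Require Import Defs.
From mathcomp Require Import all_boot all_order all_algebra.
From mathcomp Require Import all_classical all_reals all_analysis.
From mathcomp Require Import measurable_realfun ring lra.

Import Order.TTheory GRing.Theory Num.Theory.

Local Open Scope ring_scope.

Set Implicit Arguments.
Unset Strict Implicit.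
Unset Printing Implicit Defensive.

(** * Lipschitz functions and induction over the reals *)

Lemma last_le0 (R : realType) (g : R -> R) (L a b : R) :
  (forall x y, x <= y -> `|g y - g x| <= L * (y - x)) -> a <= b -> g a <= 0 ->
  exists2 c, a <= c <= b & g c <= 0 /\ forall w, c < w <= b -> 0 < g w.
Proof.
move=> gL ab ga.
pose S := [set w | a <= w <= b /\ g w <= 0]%classic.
have Sa : S a by split; rewrite ?lexx.
have Sub : ubound S b by move=> w [/andP[_ ->]].
have Ssup : has_sup S by split; [exists a | exists b].
have cb : sup S <= b by apply: ge_sup => //; exists a.
have ac : a <= sup S by apply: ub_le_sup => //; exists b.
exists (sup S); first by rewrite ac cb.
split; last first.
  move=> w /andP[cw wb]; rewrite ltNge; apply/negP => gw.
  suff : w <= sup S by rewrite leNgt cw.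
  apply: ub_le_sup; first by exists b.
  by split=> //; rewrite wb andbT (le_trans ac)// ltW.
rewrite leNgt; apply/negP => gc.
have L0 : 0 <= L.
  have := gL 0 1 ler01; rewrite subr0 mulr1; exact: le_trans.
(* Within this distance of [sup S], [g] drops by less than [g (sup S)] and stays positive; [L + 1]
   avoids dividing by zero. *)
have d0 : 0 < g (sup S) / (L + 1) by rewrite divr_gt0// ltr_wpDl.
have [w Sw /=] := sup_adherent d0 Ssup.
have wc : w <= sup S by apply: ub_le_sup => //; exists b.
move: Sw => [_ gw]; rewrite ltrBlDr -ltrBlDl ltr_pdivlMr ?ltr_wpDl// => H.
have := gL _ _ wc; rewrite ler_norml => /andP[_]; nra.
Qed.

(** At the infimum of the counterexamples [P] holds by the second premise, and the third pushes it
    past the infimum. [P] may jump at a point, as happens at arrivals. *)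
Lemma real_induction (R : realType) (P : R -> Prop) :
  (forall v, v < 0 -> P v) ->
  (forall v, 0 <= v -> (forall u, u < v -> P u) -> P v) ->
  (forall v, 0 <= v -> P v -> exists2 d, 0 < d &
     forall w, v < w <= v + d -> P w) ->
  forall v, P v.
Proof.
move=> Pneg Pleft Pright v.
apply: contrapT => nPv.
pose S := [set w | ~ P w]%classic.
have Slb : lbound S 0 by move=> w nPw; rewrite leNgt; apply/negP => /Pneg.
have Sinf : has_inf S by split; [exists v | exists 0].
have c0 : 0 <= inf S by apply: lb_le_inf => //; exists v.
have below u : u < inf S -> P u.
  move=> uc; apply: contrapT => nPu; move: uc; rewrite ltNge => /negP; apply.
  by apply: ge_inf => //; exists 0.
have Pc := Pleft _ c0 below.
have [d d0 Pd] := Pright _ c0 Pc.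
have [w Sw wd] := inf_adherent d0 Sinf.
have cw : inf S <= w by apply: ge_inf => //; exists 0.
apply: (Sw); apply: Pd; rewrite (ltW wd) andbT lt_neqAle cw andbT.
by apply/eqP => cE; apply: Sw; rewrite -cE.
Qed.

Lemma exists_delta (R : realType) (T : finType) (P : pred T) (g : T -> R) :
  (forall i, P i -> 0 < g i) -> exists2 d, 0 < d & forall i, P i -> d < g i.
Proof.
move=> gP.
(* The default 1 covers an empty [P]; halving makes the inequality strict. *)
exists ((\big[Num.min/1]_(i | P i) g i) / 2).
  rewrite divr_gt0//; elim/big_ind: _ => // x y x0 y0.
  by rewrite lt_min x0.
move=> i Pi; rewrite ltr_pdivrMr//.
have : \big[Num.min/1]_(i | P i) g i <= g i by exact: bigmin_le_cond.
by have := gP i Pi; lra.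
Qed.

(** * Integrals of processing rates *)

Section Cumulative.
Variable R : realType.
Implicit Types (f g : R -> R) (a b c w : R).
Local Notation mu := (@lebesgue_measure R).

(** [work x j] unfolds to [cum (x j)]. For [b < 0] the interval is empty and the value is 0. *)
Definition cum f b : R := \int[mu]_(u in `[0, b]%classic) f u.

Definition is_rate f := measurable_fun [set: R]%classic f /\ forall u, 0 <= f u <= 1.

Lemma rate_integrable f (r : is_rate f) (i : interval R) :
  (mu [set` i]%classic < +oo)%E -> mu.-integrable [set` i]%classic (EFin \o f).
Proof.
move=> ioo; case: r => mf f01.
apply: (@le_integrable _ _ _ mu _ _ _ (EFin \o cst 1)) => //.
- by apply/measurable_EFinP; exact: measurable_funS mf.
- move=> u _ /=; rewrite lee_fin normr1 ger0_norm.
    by case/andP: (f01 u).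
  by case/andP: (f01 u).
- apply/integrableP; split; first exact/measurable_EFinP.
  by under eq_integral do rewrite /= normr1; rewrite integral_cst//= mul1e.
Qed.

Lemma itv_fin (a b : bool) (x y : R) : (mu [set` Interval (BSide a x) (BSide b y)]%classic < +oo)%E.
Proof. by rewrite lebesgue_measure_itv/=; case: ifP => // _; rewrite -EFinB ltry. Qed.

Lemma cum_neg f b : b <= 0 -> cum f b = 0.
Proof.
rewrite le_eqVlt => /predU1P[->|b0]; rewrite /cum.
  by rewrite set_itv1 Rintegral_set1.
by rewrite set_itv_ge ?Rintegral_set0// bnd_simp -ltNge.
Qed.

Lemma cumB f (r : is_rate f) a b : 0 <= a <= b ->
  cum f b - cum f a = \int[mu]_(u in `]a, b]%classic) f u.
Proof.
move=> /andP[a0 ab]; rewrite /cum Rintegral_itvB ?bnd_simp//.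
exact/rate_integrable/itv_fin.
Qed.

Lemma cum_incr f g (rf : is_rate f) (rg : is_rate g) a b : a <= b ->
  (forall w, a < w <= b -> f w <= g w) -> cum f b - cum f a <= cum g b - cum g a.
Proof.
wlog a0 : a / 0 <= a => [H ab fg|].
  have [a0|a0] := leP 0 a; first exact: H.
  have [b0|b0] := leP b 0; first by rewrite !cum_neg// ltW.
  have := H 0 (lexx _) (ltW b0); rewrite !(cum_neg _ (ltW a0))//.
  rewrite !(cum_neg _ (lexx 0)); apply=> w /andP[w0 wb].
  by apply: fg; rewrite wb andbT (lt_trans a0).
move=> ab fg; rewrite !cumB ?a0//.
by apply: le_Rintegral => //; exact/rate_integrable/itv_fin.
Qed.

Lemma rate_cst (k : R) : 0 <= k <= 1 -> is_rate (cst k).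
Proof. by move=> k01; split. Qed.

Lemma cum_cst (k : R) b : 0 <= b -> cum (cst k) b = k * b.
Proof.
move=> b0; rewrite /cum Rintegral_cst//= lebesgue_measure_itv/= lte_fin.
by case: ltP => //= ; rewrite ?subr0// => b0'; have -> : b = 0 by lra.
Qed.

Lemma cum_mono f (r : is_rate f) a b : a <= b -> cum f a <= cum f b.
Proof.
move=> ab; rewrite -subr_ge0.
have r0 : is_rate (cst 0) by apply: rate_cst; rewrite lexx ler01.
have E x : cum (cst 0) x = 0 by rewrite /cum Rintegral_cst// mul0r.
have -> : 0 = cum (cst 0) b - cum (cst 0) a by rewrite !E subrr.
by apply: cum_incr => // w _; case: r => _ /(_ w)/andP[].
Qed.

Lemma cum_ge0 f (r : is_rate f) b : 0 <= cum f b.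
Proof.
have [b0|b0] := leP 0 b; last by rewrite cum_neg// ltW.
by rewrite -(cum_neg f (lexx 0)); exact: cum_mono.
Qed.

Lemma cum_lip f (r : is_rate f) a b : a <= b -> cum f b - cum f a <= b - a.
Proof.
move=> ab; have r1 : is_rate (cst 1) by apply: rate_cst; rewrite lexx ler01.
have H : cum f b - cum f a <= cum (cst 1) b - cum (cst 1) a.
  by apply: cum_incr => // w _; case: r => _ /(_ w)/andP[].
apply: le_trans H _.
have [b0|b0] := leP b 0; first by rewrite !cum_neg ?(le_trans ab)//; lra.
rewrite (cum_cst _ (ltW b0)).
have [a0|a0] := leP a 0; first by rewrite cum_neg//; lra.
by rewrite cum_cst ?(ltW a0)//; lra.
Qed.

Lemma cum_norm f (r : is_rate f) a b : a <= b -> `|cum f b - cum f a| <= 1 * (b - a).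
Proof.
by move=> ab; rewrite ger0_norm ?mul1r ?cum_lip// subr_ge0 cum_mono.
Qed.

Lemma cum_eq f g (rf : is_rate f) (rg : is_rate g) a b : a <= b ->
  (forall w, a < w <= b -> f w = g w) -> cum f b - cum f a = cum g b - cum g a.
Proof.
by move=> ab fg; apply/le_anti/andP; split; apply: cum_incr => // w /fg ->.
Qed.

Lemma cum_idle f (r : is_rate f) a b : a <= b ->
  (forall w, a < w <= b -> f w = 0) -> cum f b = cum f a.
Proof.
move=> ab f0; apply/le_anti/andP; split; last exact: cum_mono.
rewrite -subr_le0.
have r0 : is_rate (cst 0) by apply: rate_cst; rewrite lexx ler01.
rewrite (cum_eq r r0)//.
by rewrite /cum !Rintegral_cst// !mul0r subrr.
Qed.

(** After the last time at which [cum f <= c], the rate vanishes and the integral stays put. This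
    serves for caps on the work of a job. *)
Lemma cum_stop f (r : is_rate f) a b c : a <= b ->
  (forall w, a < w <= b -> c < cum f w -> f w = 0) ->
  cum f b <= Num.max (cum f a) c.
Proof.
move=> ab fc; rewrite le_max.
have [ac|ca] := leP (cum f a) c; last first.
  rewrite (cum_idle r ab) ?lexx// => w /andP[aw wb].
  by apply: fc; rewrite ?aw// (lt_le_trans ca)// cum_mono// ltW.
have [|||d /andP[ad db] [dc H]] := @last_le0 _ (fun x => cum f x - c) 1 a b => //.
- by move=> x y xy; rewrite opprB addrA subrK; exact: cum_norm.
- by rewrite subr_le0.
apply/orP; right; rewrite (@cum_idle _ r d b)//; first by lra.
move=> w /andP[dw wb]; apply: fc; first by rewrite wb (le_lt_trans ad).
by rewrite -subr_gt0; apply: H; rewrite dw.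
Qed.

Lemma cum_ivt f (r : is_rate f) a b c : a <= b -> cum f a <= c <= cum f b ->
  exists2 w, a <= w <= b & cum f w = c.
Proof.
move=> ab /andP[ac cb].
have [|||d /andP[ad db] [dc H]] := @last_le0 _ (fun x => cum f x - c) 1 a b => //.
- by move=> x y xy; rewrite opprB addrA subrK; exact: cum_norm.
- by rewrite subr_le0.
exists d; first by rewrite ad.
apply/eqP; rewrite eq_le; rewrite subr_le0 in dc; rewrite dc /= leNgt.
apply/negP => dc'.
have db' : d < b by rewrite lt_neqAle db andbT; apply/eqP => E; move: dc'; rewrite E; lra.
(* By the Lipschitz bound [cum f] is still below [c] at [d + e], although [d] is the last such
   time. *)
pose e := Num.min ((c - cum f d) / 2) (b - d).
have e0 : 0 < e by rewrite lt_min; apply/andP; split; lra.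
have eb : e <= b - d by rewrite ge_min lexx orbT.
have ec : e <= (c - cum f d) / 2 by rewrite ge_min lexx.
have := H (d + e); have := @cum_lip _ r d (d + e); lra.
Qed.

(** A growing integral would first take a value [d < c] above [cum f a]; up to that time it is below
    [c], so the rate is zero and nothing could grow. *)
Lemma cum_start f (r : is_rate f) a b c : a <= b -> cum f a < c ->
  (forall w, a < w <= b -> cum f w < c -> f w = 0) -> cum f b = cum f a.
Proof.
move=> ab ac fc; apply/le_anti/andP; split; last exact: cum_mono.
rewrite leNgt; apply/negP => ab'.
pose d := Num.min (cum f b) ((cum f a + c) / 2).
have ad : cum f a < d by rewrite lt_min ab'/=; lra.
have dc : d < c by rewrite gt_min; apply/orP; right; lra.
have db : d <= cum f b by rewrite ge_min lexx.
have [||w /andP[aw wb] wd] := @cum_ivt _ r a b d => //; first by rewrite (ltW ad).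
move: ad; rewrite -wd (@cum_idle _ r a w) ?ltxx// => u /andP[au uw].
apply: fc; first by rewrite au (le_trans uw).
by rewrite (le_lt_trans _ dc)// -wd cum_mono.
Qed.

Lemma rate_sum (T : finType) (F : T -> R -> R) :
  (forall i, measurable_fun [set: R]%classic (F i)) -> (forall i u, 0 <= F i u) ->
  (forall u, \sum_i F i u <= 1) -> is_rate (fun u => \sum_i F i u).
Proof.
move=> mF F0 F1; split; first exact: measurable_sum.
by move=> u; rewrite F1 sumr_ge0.
Qed.

Lemma cum_sum (T : finType) (F : T -> R -> R) b : (forall i, is_rate (F i)) ->
  cum (fun u => \sum_i F i u) b = \sum_i cum (F i) b.
Proof.
move=> rF; rewrite /cum /Rintegral.
have iF i : mu.-integrable `[0, b]%classic (EFin \o F i).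
  exact/rate_integrable/itv_fin.
under eq_integral do rewrite -sumEFin.
rewrite (@integral_sum _ _ _ mu _ _ _ (fun i => EFin \o F i))//.
by rewrite -sum_fine// => i _; exact: integrable_fin_num.
Qed.

Lemma cum_congr f g b : (forall w, 0 < w <= b -> f w = g w) ->
  is_rate f -> is_rate g -> cum f b = cum g b.
Proof.
move=> fg rf rg; have [b0|b0] := leP b 0; first by rewrite !cum_neg.
by have := cum_eq rf rg (ltW b0) fg; rewrite !(cum_neg _ (lexx 0)) !subr0.
Qed.

Lemma cum_idle_complement f g b : is_rate f -> is_rate g -> 0 <= b ->
  cum (fun u => f u + (1 - g u)) b = cum f b + (b - cum g b).
Proof.
move=> rf rg b0; have -> : b - cum g b = cum (cst 1) b - cum g b by rewrite cum_cst ?mul1r.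
rewrite /cum.
have r1 : is_rate (cst 1) by apply: rate_cst; rewrite lexx ler01.
have int k : is_rate k -> mu.-integrable `[0, b]%classic (EFin \o k).
  by move=> rk; apply: rate_integrable => //; exact: itv_fin.
have int1B : mu.-integrable `[0, b]%classic (EFin \o (fun u => cst 1 u - g u)).
  by apply: (@integrableB _ _ _ mu _ _ (EFin \o cst 1) (EFin \o g)) => //; exact: int.
have E := RintegralD _ (int _ rf) int1B; rewrite [LHS]E//.
by congr (_ + _); apply: RintegralB => //; exact: int.
Qed.

Lemma rate_locally_integrable f (r : is_rate f) : locally_integrable [set: R]%classic f.
Proof.
case: r => mf f01; split=> //; first exact: openT.
move=> K _ cK.
apply: (@le_lt_trans _ _ (\int[mu]_(x in K) (cst 1 x))%E).
  apply: ge0_le_integral => //; first exact: compact_measurable.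
    by apply/measurable_EFinP/measurableT_comp => //; exact: measurable_funS mf.
  by move=> u _; rewrite lee_fin ger0_norm; case/andP: (f01 u).
by rewrite integral_cst ?mul1e ?compact_finite_measure//; exact: compact_measurable.
Qed.

Lemma cum_ae_derivable f (r : is_rate f) :
  {ae mu, forall w, 0 < w -> derivable (cum f) w 1 /\ (cum f)^`()%classic w = f w}.
Proof.
have H := @FTC1 R f (BLeft 0)
  (fun y => rate_integrable r (itv_fin true false 0 y)) (rate_locally_integrable r).
apply: filterS H; first exact: (ae_filter_ringOfSetsType mu).
by move=> w H w0; apply: H; rewrite lte_fin.
Qed.

(* At a point where both densities are derivatives of their integrals, a strictly
   larger rate means that the difference of the integrals was smaller just before. *)
Lemma rate_density f g (rf : is_rate f) (rg : is_rate g) a b : 0 <= a -> a <= b ->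
  cum f a < cum f b ->
  exists2 w, a < w <= b & 0 < f w /\ (g w < f w ->
    exists2 w', a <= w' < w & cum f w' - cum g w' < cum f w - cum g w).
Proof.
move=> a0 ab fab; apply: contrapT => nex.
(* Without such a point, [f] vanishes wherever both integrals have their densities as derivatives,
   hence almost everywhere. *)
suff : cum f b - cum f a = 0 by lra.
rewrite cumB ?a0// /Rintegral.
rewrite (@ae_eq_integral _ _ _ mu _ (cst 0%E))//; first by rewrite integral0.
  by apply/measurable_EFinP; apply: measurable_funS (rf.1).
have F := ae_filter_ringOfSetsType mu.
apply: (@filterS _ _ F) (filterI (cum_ae_derivable rf) (cum_ae_derivable rg)).
move=> w [df dg] /=; rewrite in_itv/= => /andP[aw wb].
have w0 : 0 < w by exact: le_lt_trans aw.
have [{}df f'] := df w0; have [{}dg g'] := dg w0.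
congr EFin; apply: contrapT => fw0; apply: nex; exists w; rewrite ?aw//.
have fw : 0 < f w by rewrite lt_neqAle eq_sym (introN eqP fw0)/=; case/andP: (rf.2 w).
split=> // gf.
have dB : derivable (cum f - cum g) w 1 by exact: derivableB.
have DB : 'D_1 (cum f - cum g) w = f w - g w.
  by rewrite deriveB// -!derive1E f' g'.
have := dB; rewrite /derivable -/('D_1 (cum f - cum g) w) DB.
move=> /(@cvgr_gt _ _ _ _ _ (f w - g w))/(_ 0).
rewrite subr_gt0 => /(_ gf) [e /= e0 He].
(* A backward step short enough for the difference quotient to be positive and for [w - d] not to
   pass [a]. *)
pose d := Num.min (e / 2) (w - a).
have d0 : 0 < d by rewrite lt_min subr_gt0 aw divr_gt0.
have de : d < e by rewrite gt_min; apply/orP; left; lra.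
have da : d <= w - a by rewrite ge_min lexx orbT.
exists (w - d); first by apply/andP; split; lra.
have := He (- d); rewrite /= opprK add0r gtr0_norm// oppr_eq0 => /(_ de (lt0r_neq0 d0)).
rewrite /GRing.scale/= mulr1 mulrC nmulr_lgt0 ?invr_lt0 ?oppr_lt0//.
by rewrite !fctE [- d + w]addrC; lra.
Qed.
End Cumulative.

(** * Feasible and optimal schedules *)

(** The infimum of the times at which [p] is reached is attained by the Lipschitz bound. The
    equivalence describes completion times without infima. *)
Lemma cum_reach (R : realType) (f : R -> R) (p : R) : is_rate f -> 0 < p ->
  (exists s, p <= cum f s) -> exists2 c, 0 < c & forall s, (p <= cum f s) = (c <= s).
Proof.
move=> rf p0 [s0 ps0].
pose S := [set s | p <= cum f s]%classic.
have Slb : lbound S 0.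
  move=> s; rewrite /S/= => ps; rewrite leNgt; apply/negP => /ltW s0'.
  by move: ps; rewrite cum_neg//; lra.
have Sinf : has_inf S by split; [exists s0 | exists 0].
have pc : p <= cum f (inf S).
  rewrite leNgt; apply/negP => cp.
  have d0 : 0 < p - cum f (inf S) by rewrite subr_gt0.
  have [w Sw wd] := inf_adherent d0 Sinf.
  have cw : inf S <= w by apply: ge_inf => //; exists 0.
  have := cum_lip rf cw; rewrite /S/= in Sw; lra.
have c0 : 0 < inf S.
  by rewrite ltNge; apply/negP => c0; move: pc; rewrite cum_neg//; lra.
exists (inf S) => // s; apply/idP/idP => [ps|cs]; first by apply: ge_inf => //; exists 0.
exact: le_trans (cum_mono rf cs).
Qed.

Section Feasible.
Variables (R : realType) (I : instance R).
Implicit Types (x y : schedule I) (i j : job I) (a b s u v : R).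

Definition total_work x s : R := \sum_j work x j s.

Lemma feasible_rate x j : feasible x -> is_rate (x j).
Proof.
move=> fx; split; first exact: feasible_measurable.
move=> u; rewrite feasible_ge0//=; apply: le_trans (feasible_sum_le1 fx u).
by rewrite (bigD1 j)//= lerDl sumr_ge0// => i _; exact: feasible_ge0.
Qed.

Lemma feasible_sum_rate x : feasible x -> is_rate (fun u => \sum_j x j u).
Proof.
move=> fx; apply: rate_sum; [exact: feasible_measurable|exact: feasible_ge0|].
exact: feasible_sum_le1.
Qed.

Lemma total_workE x s : feasible x -> total_work x s = cum (fun u => \sum_j x j u) s.
Proof. by move=> fx; rewrite cum_sum// => j; exact: feasible_rate. Qed.

Lemma work_ge0 x j s : feasible x -> 0 <= work x j s.
Proof. by move=> /(@feasible_rate _ j)/cum_ge0; exact. Qed.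

Lemma work_mono x j a b : feasible x -> a <= b -> work x j a <= work x j b.
Proof. by move=> /(@feasible_rate _ j)/cum_mono; exact. Qed.

Lemma work_lip x j a b : feasible x -> a <= b -> work x j b - work x j a <= b - a.
Proof. by move=> /(@feasible_rate _ j)/cum_lip; exact. Qed.

Lemma work_idle x j a b : feasible x -> a <= b ->
  (forall w, a < w <= b -> x j w = 0) -> work x j b = work x j a.
Proof. by move=> /(@feasible_rate _ j)/cum_idle; exact. Qed.

(** Feasibility only forbids processing a finished job; the work therefore stops growing at
    [proc j]. *)
Lemma work_le_proc x j s : feasible x -> work x j s <= proc j.
Proof.
move=> fx; have [s0|s0] := leP s 0.
  by rewrite [work _ _ _]cum_neg ?(ltW s0)// ltW// proc_gt0.
have := cum_stop (feasible_rate j fx) (c := proc j) (ltW s0).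
rewrite (cum_neg _ (lexx 0)) (max_idPr (ltW (proc_gt0 j))); apply=> w _ pw.
apply: feasible_active => //; rewrite inE negb_and -leNgt subr_le0 -/(cum _ _).
by rewrite (ltW pw) orbT.
Qed.

Lemma remaining_ge0 x j s : feasible x -> 0 <= remaining x j s.
Proof. by move=> fx; rewrite subr_ge0 work_le_proc. Qed.

Lemma remaining_anti x j a b : feasible x -> a <= b -> remaining x j b <= remaining x j a.
Proof. by move=> fx ab; rewrite lerD2l lerN2 work_mono. Qed.

Lemma remaining_lip x j a b : feasible x -> a <= b ->
  remaining x j a - remaining x j b <= b - a.
Proof.
move=> fx ab; by have := work_lip j fx ab; rewrite /remaining; lra.
Qed.

Lemma work_unreleased x j s : feasible x -> s <= release j -> work x j s = 0.
Proof.
move=> fx; have early u : u < release j -> work x j u = 0.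
  move=> uj; have [u0|u0] := leP u 0; first by rewrite [work _ _ _]cum_neg.
  rewrite (@work_idle x j 0 u)// ?ltW//; first by rewrite [work _ _ _]cum_neg.
  move=> w /andP[_ wu]; apply: feasible_active => //.
  by rewrite inE negb_and -ltNge (le_lt_trans wu uj).
move=> sj; apply/eqP; rewrite eq_le work_ge0// andbT leNgt; apply/negP => sw.
(* The Lipschitz bound carries the value 0 from times before the release to the release itself. *)
have lt_s : s - work x j s / 2 < s by rewrite ltrBlDr ltrDl divr_gt0.
have := work_lip j fx (ltW lt_s).
by rewrite (early _ (lt_le_trans lt_s sj)); lra.
Qed.

Lemma total_work_mono x a b : feasible x -> a <= b -> total_work x a <= total_work x b.
Proof. by move=> fx ab; apply: ler_sum => j _; exact: work_mono. Qed.

Lemma total_work_lip x a b : feasible x -> a <= b ->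
  total_work x b - total_work x a <= b - a.
Proof. by move=> fx ab; rewrite !total_workE//; exact/cum_lip/ab/feasible_sum_rate. Qed.

(** Unreleased jobs have received no work, so comparing the released volumes of two schedules
    amounts to comparing their total work. *)
Lemma sum_remaining_released x s : feasible x ->
  \sum_(j | release j <= s) remaining x j s =
  \sum_(j : job I | release j <= s) proc j - total_work x s.
Proof.
move=> fx; rewrite sumrB; congr (_ - _).
rewrite /total_work [RHS](bigID (fun j => release j <= s))/= [X in _ + X]big1 ?addr0//.
by move=> j; rewrite -ltNge => /ltW; exact: work_unreleased.
Qed.

Lemma active_release x j s : j \in active x s -> release j <= s.
Proof. by rewrite inE => /andP[]. Qed.

Lemma active_gt0 x j s : j \in active x s -> 0 < remaining x j s.
Proof. by rewrite inE => /andP[]. Qed.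

Lemma inactive_remaining x j s : feasible x -> release j <= s ->
  j \notin active x s -> remaining x j s = 0.
Proof.
move=> fx js; rewrite inE js/= -leNgt => r0.
by apply/eqP; rewrite eq_le r0 remaining_ge0.
Qed.

(** * Work conservation, completion times and optimality *)

Definition work_conserving x := forall s, active x s != finset.set0 -> \sum_j x j s = 1.

Lemma total_work_busy x a b : feasible x -> 0 <= a -> a <= b ->
  (forall w, a < w <= b -> \sum_j x j w = 1) -> total_work x b - total_work x a = b - a.
Proof.
move=> fx a0 ab busy; rewrite !total_workE//.
have r1 : is_rate (cst (1:R)) by apply: rate_cst; rewrite lexx ler01.
rewrite (cum_eq (feasible_sum_rate fx) r1)//.
by rewrite !cum_cst ?mul1r// (le_trans a0).
Qed.

Lemma work_conserving_finishes x j : feasible x -> work_conserving x ->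
  exists s, proc j <= work x j s.
Proof.
move=> fx wc; pose a := release j; pose P := \sum_(i : job I) proc i.
have P0 : 0 <= P by apply: sumr_ge0 => i _; rewrite ltW ?proc_gt0.
(* Were [j] unfinished then, the machine would have been busy for [P + 1] units since its release,
   with only [P] units of work in the whole instance. *)
exists (a + (P + 1)); rewrite leNgt; apply/negP => wj.
have ab : a <= a + (P + 1) by rewrite lerDl addr_ge0.
have : total_work x (a + (P + 1)) - total_work x a = (a + (P + 1)) - a.
  apply: total_work_busy => //; first exact: release_ge0.
  move=> w /andP[aw wb]; apply: wc; apply/set0Pn; exists j.
  by rewrite inE (ltW aw) subr_gt0 (le_lt_trans _ wj)// work_mono.
have : total_work x (a + (P + 1)) <= P by apply: ler_sum => i _; exact: work_le_proc.
have : 0 <= total_work x a by apply: sumr_ge0 => i _; exact: work_ge0.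
by lra.
Qed.

Lemma completionE x j (c : R) : (forall s, (proc j <= work x j s) = (c <= s)) ->
  completion x j = c%:E.
Proof.
move=> H; apply/le_anti/andP; split.
  by apply: ereal_inf_lbound; exists c => //=; rewrite subr_le0 H.
by apply: le_ereal_inf_tmp => _ [s /= + <-]; rewrite subr_le0 H lee_fin.
Qed.

Lemma completion_ge0 x j : (0 <= completion x j)%E.
Proof.
apply: le_ereal_inf_tmp => _ [s /= rs <-]; rewrite lee_fin leNgt; apply/negP => /ltW s0.
have := proc_gt0 j; move: rs; rewrite /remaining [work _ _ _]cum_neg//; lra.
Qed.

Lemma completion_pinfty x j : ~ (exists s, proc j <= work x j s) -> completion x j = +oo%E.
Proof.
move=> H; rewrite /completion (_ : [set s | _]%classic = set0) ?image_set0 ?ereal_inf0//.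
by apply/seteqP; split=> // s /= rs; apply: H; exists s; rewrite -subr_le0.
Qed.

Lemma feasible_completion x j : feasible x -> (exists s, proc j <= work x j s) ->
  exists2 c, 0 < c & forall s, (proc j <= work x j s) = (c <= s).
Proof. by move=> fx; apply: cum_reach (proc_gt0 j); exact: feasible_rate. Qed.

Lemma total_flowE x (c : job I -> R) : (forall j, completion x j = (c j)%:E) ->
  total_flow x = (\sum_j (c j - release j))%:E.
Proof.
by move=> H; rewrite -sumEFin; apply: eq_bigr => j _; rewrite H EFinB.
Qed.

(** The work-conserving schedule has finite total flow, while a job that never finishes makes the
    total flow infinite. *)
Lemma optimal_finishes x y j : feasible x -> work_conserving x -> optimal y ->
  exists s, proc j <= work y j s.
Proof.
move=> fx wc [fy opty]; apply: contrapT => /completion_pinfty yj.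
have /choice[c Hc] i : exists c, completion x i = c%:E.
  have [c _ /completionE E] := feasible_completion fx (work_conserving_finishes i fx wc).
  by exists c.
have := opty x fx; rewrite (total_flowE Hc).
suff -> : total_flow y = +oo%E by rewrite leye_eq.
apply/eqP; rewrite /total_flow esum_eqy.
  by apply/existsP; exists j; rewrite yj.
(* No summand is [-oo], so a single [+oo] decides the sum. *)
move=> i _; rewrite -ltNye (lt_le_trans _ (leeD2r _ (completion_ge0 y i)))//.
by rewrite add0e ltNyr.
Qed.

(* In [y'], job [j] also receives the idle capacity of [y] from its release until it is
   finished. *)
Lemma fill_idle y j c : feasible y ->
  (forall s, (proc j <= work y j s) = (c <= s)) -> release j <= c ->
  total_work y c - total_work y (release j) < c - release j ->
  exists2 y', feasible y' & (forall i, i != j -> y' i = y i) /\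
    exists2 c', c' < c & forall s, (proc j <= work y' j s) = (c' <= s).
Proof.
move=> fy cE ac idle; pose a := release j.
have a0 : 0 <= a by exact: release_ge0.
pose h0 u := y j u + (1 - \sum_i y i u).
have rS := feasible_sum_rate fy; have rj := feasible_rate j fy.
have mh0 : measurable_fun [set: R]%classic h0.
  apply: measurable_funD; first exact: rj.1.
  by apply: measurable_funB => //; exact: rS.1.
have h001 u : 0 <= h0 u <= 1.
  have S1 := feasible_sum_le1 fy u.
  rewrite addr_ge0 ?subr_ge0 ?feasible_ge0//= /h0 (bigD1 j)//=.
  have : 0 <= \sum_(i | i != j) y i u by apply: sumr_ge0 => i _; exact: feasible_ge0.
  by lra.
pose on (i : interval R) u := h0 u * \1_([set` i]%classic) u.
have onE (i : interval R) u : on i u = if u \in i then h0 u else 0.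
  by rewrite /on indicE mem_setE; case: ifP; rewrite ?mulr1 ?mulr0.
have r_on (i : interval R) : is_rate (on i).
  split; first by apply: measurable_funM => //; exact: measurable_indic.
  by move=> u; rewrite onE; case: ifP => // _; rewrite lexx ler01.
have rh0 : is_rate h0 by [].
(* [h] has no end yet: it exceeds [proc j] at [c], hence reaches it at some [c' < c], where it is
   then cut off. *)
pose h := on `[a, +oo[; have rh : is_rate h by exact: r_on.
have hc : proc j < cum h c.
  have hw w : a < w <= c -> h w = h0 w.
    by move=> /andP[aw _]; rewrite /h onE in_itv/= andbT ltW.
  have E1 := cum_eq rh rh0 ac hw.
  have E2 b : 0 <= b -> cum h0 b = work y j b + (b - total_work y b).
    by move=> b0; rewrite total_workE//; exact: cum_idle_complement.
  rewrite !E2 ?(le_trans a0)// in E1.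
  have wa := work_unreleased fy (lexx (release j)); have := cE c; rewrite lexx.
  have := cum_ge0 rh a; move: E1 idle; rewrite -/a in wa *; lra.
have [c' c'0 c'E] := cum_reach rh (proc_gt0 j) (ex_intro _ c (ltW hc)).
have c'c : c' < c.
  pose d := (cum h c - proc j) / 2.
  have d0 : 0 < d by rewrite divr_gt0// subr_gt0.
  have cd : c - d <= c by rewrite lerBlDr lerDl ltW.
  have : c' <= c - d by rewrite -c'E; have := cum_lip rh cd; rewrite /d; lra.
  by move=> /le_lt_trans; apply; rewrite ltrBlDr ltrDl.
(* The interval is open at [c'] because [j] is no longer active there. *)
pose g := on `[a, c'[; have rg : is_rate g by exact: r_on.
pose y' i := if i == j then g else y i.
have wE s : s < c' -> cum g s = cum h s.
  move=> sc; apply: cum_congr => // w /andP[_ ws].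
  by rewrite /g /h !onE !in_itv/= (le_lt_trans ws sc).
have w' : proc j <= cum g c'.
  rewrite leNgt; apply/negP => gc.
  pose s := c' - (proc j - cum g c') / 2.
  have sc : s < c' by rewrite ltrBlDr ltrDl divr_gt0// subr_gt0.
  have := cum_lip rh (ltW sc); have := cum_mono rg (ltW sc); rewrite wE//.
  by have := c'E c'; rewrite lexx /s; lra.
have wy' s : (proc j <= work y' j s) = (c' <= s).
  rewrite /work /y' eqxx -/(cum _ _); have [cs|sc] := leP c' s.
    by rewrite (le_trans w')// cum_mono.
  by rewrite wE// c'E leNgt sc.
exists y'; last first.
  by split; [move=> i /negPf ij; rewrite /y' ij | exists c'].
split.
- by move=> i; rewrite /y'; case: eqP => // _; [exact: rg.1 | exact: feasible_measurable].
- move=> i s; rewrite /y'; case: eqP => // _; last exact: feasible_ge0.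
  by case/andP: (rg.2 s).
- move=> s; rewrite (bigD1 j)//= (_ : y' j s = g s); last by rewrite /y' eqxx.
  rewrite (eq_bigr (fun i => y i s)); last by move=> i /negPf ij; rewrite /y' ij.
  have := feasible_sum_le1 fy s; rewrite /g onE /h0 (bigD1 j)//=.
  by case: ifP => _; have := feasible_ge0 fy j s; lra.
- move=> i s; rewrite inE /remaining subr_gt0 ltNge.
  have [->|ij] := eqVneq i j; last first.
    have E : y' i = y i by rewrite /y' (negPf ij).
    rewrite /work E -/(work y i s) => H.
    by apply: feasible_active => //; rewrite inE subr_gt0 ltNge.
  rewrite wy' negb_and negbK -ltNge /y' eqxx /g onE => H.
  rewrite in_itv/= (_ : _ && _ = false)//; apply/negP; apply/negP.
  by rewrite negb_and -ltNge -leNgt.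
Qed.


(** Idle capacity between release and completion of [j] would let [j] finish earlier while all other
    completion times are kept, which lowers the total flow. *)
Lemma optimal_no_idle x y j c : feasible x -> work_conserving x -> optimal y ->
  (forall s, (proc j <= work y j s) = (c <= s)) ->
  c - release j <= total_work y c - total_work y (release j).
Proof.
move=> fx wc opty cE; have [fy miny] := opty.
have ac : release j <= c.
  rewrite leNgt; apply/negP => /ltW ca; have := cE c.
  by rewrite work_unreleased// lexx leNgt proc_gt0.
rewrite leNgt; apply/negP => idle.
have [y' fy' [y'i [c' c'c c'E]]] := fill_idle fy cE ac idle.
have /choice[d dE] i : exists d, forall s, (proc i <= work y i s) = (d <= s).
  have [d _ dE] := feasible_completion fy (optimal_finishes i fx wc opty).
  by exists d.
have cd : c = d j by apply/le_anti; rewrite -cE dE lexx -dE cE lexx.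
rewrite cd in c'c.
have := miny y' fy'; rewrite (total_flowE (fun i => completionE (dE i))).
rewrite (@total_flowE y' (fun i => if i == j then c' else d i)); last first.
  move=> i; apply: completionE => s; case: eqVneq => [->//|ij].
  by rewrite /work y'i// -dE.
rewrite lee_fin (bigD1 j)//= [leRHS](bigD1 j)//= eqxx.
rewrite [X in _ <= _ + X](eq_bigr (fun i => d i - release i)); last by move=> i /negPf ->.
by rewrite lerD2r lerD2r leNgt c'c.
Qed.

Lemma total_work_inactive x y s : feasible x -> feasible y ->
  active y s = finset.set0 -> total_work x s <= total_work y s.
Proof.
move=> fx fy y0; apply: ler_sum => j _.
have [js|/ltW js] := leP (release j) s; last by rewrite !work_unreleased.
have : remaining y j s = 0 by apply: inactive_remaining => //; rewrite y0 inE.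
by move/eqP; rewrite subr_eq0 => /eqP <-; exact: work_le_proc.
Qed.

(** Take the last time [s <= v] at which [x] is not ahead. Just after [s], either [y] has finished
    all released jobs, or some job released by [s] is unfinished and [y] runs at full speed; in
    neither case can [x] get ahead. *)
Lemma optimal_total_work x y v : feasible x -> work_conserving x -> optimal y ->
  total_work x v <= total_work y v.
Proof.
move=> fx wc opty; have fy := opty.1.
have [v0|v0] := leP v 0.
  by apply: ler_sum => j _; rewrite ![work _ _ _]cum_neg.
have [|||s /andP[s0 sv] [sle sgt]] :=
    @last_le0 _ (fun w => total_work x w - total_work y w) 2 0 v.
- move=> a b ab; have := total_work_lip fx ab; have := total_work_lip fy ab.
  have := total_work_mono fx ab; have := total_work_mono fy ab.
  by rewrite ler_norml; move=> *; apply/andP; split; lra.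
- exact: ltW.
- by rewrite subr_le0; apply: ler_sum => j _; rewrite ![work _ _ _]cum_neg.
move: sv; rewrite le_eqVlt => /predU1P[<-|sv]; first by rewrite -subr_le0.
have [|d d0 dE] := @exists_delta _ _ [pred j : job I | s < release j] (fun j => release j - s).
  by move=> j; rewrite subr_gt0.
pose w := Num.min (s + d) v.
have sw : s < w by rewrite lt_min sv ltrDl d0.
have wv : w <= v by rewrite ge_min lexx orbT.
have wd : w <= s + d by rewrite ge_min lexx.
have := sgt w; rewrite sw wv subr_gt0 => /(_ isT).
rewrite ltNge => /negP []; have [y0|[j jw]] := set_0Vmem (active y w).
  exact: total_work_inactive.
have js : release j <= s.
  by rewrite leNgt; apply/negP => /dE; have := active_release jw; lra.
have [c _ cE] := feasible_completion fy (optimal_finishes j fx wc opty).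
have wc' : w < c by rewrite ltNge -cE -ltNge -subr_gt0 active_gt0.
have := optimal_no_idle fx wc opty cE.
(* [y] has no idle time from the release of [j] to [c]; the unit-speed bounds before [s] and after
   [w] leave full speed between them. *)
have := total_work_lip fy js; have := total_work_lip fy (ltW wc').
have := total_work_lip fx (ltW sw); lra.
Qed.

(** Released, finished and known are permanent by monotonicity. Their negations are finitely many
    strict inequalities, which hold for a while. *)
Lemma stable_window x eps v : feasible x -> exists2 d, 0 < d & forall w, v <= w <= v + d ->
  [/\ forall j, (release j <= w) = (release j <= v),
      active x w = active x v & known eps x w = known eps x v].
Proof.
move=> fx.
have [|d1 d10 H1] := @exists_delta _ _ [pred j : job I | v < release j] (fun j => release j - v).
  by move=> j; rewrite subr_gt0.
have [|d2 d20 H2] := @exists_delta _ _ [pred j | j \in active x v] (fun j => remaining x j v).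
  by move=> j; exact: active_gt0.
have [|d3 d30 H3] := @exists_delta _ _ [pred j | ~~ (remaining x j v <= eps * proc j)]
    (fun j => remaining x j v - eps * proc j).
  by move=> j /=; rewrite -ltNge subr_gt0.
exists (Num.min d1 (Num.min d2 d3)); first by rewrite !lt_min d10 d20.
move=> w /andP[vw wd]; rewrite -lerBlDl !le_min in wd.
case/and3P: wd => wd1 wd2 wd3.
have relE j : (release j <= w) = (release j <= v).
  apply/idP/idP => [jw|/le_trans]; last exact.
  by rewrite leNgt; apply/negP => /H1; lra.
have actE : active x w = active x v.
  apply/setP => j; rewrite !inE relE; case: (boolP (release j <= v)) => //= jv.
  apply/idP/idP => [|jr]; first by move=> /lt_le_trans; apply; exact: remaining_anti.
  by have := H2 j; rewrite !inE jv jr => /(_ isT); have := remaining_lip j fx vw; lra.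
split=> //; apply/setP => j; rewrite [LHS]inE [RHS]inE actE.
case: (j \in active x v) => //=; apply/idP/idP => [jw|]; last first.
  by apply: le_trans; exact: remaining_anti.
apply: contraT => /H3; have := remaining_lip j fx vw; lra.
Qed.

End Feasible.

(** * The SLF rule *)

Section ShortestLowerBoundFirst.
Variables (R : realType) (I : instance R) (eps : R).
Hypotheses (eps0 : 0 < eps) (eps1 : eps < 1).
Variable x : schedule I.
Hypothesis slfx : is_SLF eps x.
Implicit Types (i j k l : job I) (s u v w th : R).

Local Notation kappa := (eps / (1 - eps)).

Let fx : feasible x := slfx.1.

Lemma kappa_gt0 : 0 < kappa.
Proof. by rewrite divr_gt0// subr_gt0. Qed.

(** This and [runs_unknown] restate the two cases of [slf_rule] with real inequalities in place of
    extended minima. *)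
Definition runs_known s k := [/\ k \in known eps x s,
  forall i, i \in known eps x s -> remaining x k s <= remaining x i s,
  forall i, i \in unknown eps x s -> remaining x k s <= kappa * work x i s &
  forall i, x i s = if i == k then 1 else 0].

(** Equal sharing is weakened to what the argument uses: jobs beyond the minimal work rest, and the
    machine is fully used. *)
Definition runs_unknown s := exists2 k, k \in unknown eps x s &
  [/\ forall i, i \in unknown eps x s -> work x k s <= work x i s,
      forall l, l \in known eps x s -> kappa * work x k s < remaining x l s,
      forall i, x i s != 0 -> work x i s <= work x k s &
      \sum_i x i s = 1].

Lemma estimate_known i s : i \in known eps x s -> estimate eps x i s = remaining x i s.
Proof. by rewrite /estimate => ->. Qed.

Lemma estimate_unknown i s : i \in unknown eps x s ->
  estimate eps x i s = kappa * work x i s.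
Proof. by rewrite /estimate inE => /andP[/negPf ->]. Qed.

Lemma known_active i s : i \in known eps x s -> i \in active x s.
Proof. by rewrite inE => /andP[]. Qed.

Lemma min_estimate_le (Q : {set job I}) i s : i \in Q ->
  (min_estimate eps x Q s <= (estimate eps x i s)%:E)%E.
Proof. by move=> iQ; exact: bigmin_le_cond. Qed.

Lemma min_estimate_attained (Q : {set job I}) s : (min_estimate eps x Q s < +oo)%E ->
  exists2 k, k \in Q & (estimate eps x k s)%:E = min_estimate eps x Q s.
Proof.
have [->|[i0 i0Q] _] := set_0Vmem Q.
  by rewrite /min_estimate big_set0 ltxx.
case: (arg_minP (fun i => estimate eps x i s) i0Q) => k kQ kmin.
exists k => //; apply/le_anti; rewrite min_estimate_le// andbT.
by apply: le_bigmin => [|i iQ]; rewrite ?leey// lee_fin kmin.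
Qed.

Lemma slf_step s j : j \in active x s -> (exists k, runs_known s k) \/ runs_unknown s.
Proof.
move=> /(slfx.2 s j); rewrite /slf_rule; case: ifPn => [KU [k [kK kmin xk]]|].
  left; exists k; split=> // i iQ.
    by rewrite -!estimate_known// -lee_fin kmin min_estimate_le.
  rewrite -estimate_known// -estimate_unknown// -lee_fin kmin.
  by apply: le_trans KU _; rewrite min_estimate_le.
rewrite -ltNge => UK xM; right.
(* Being strictly below another minimum, the minimum over the unknown jobs is finite, hence
   attained. *)
have [k kU kmin] := min_estimate_attained (lt_le_trans UK (leey _)).
exists k => //; split.
- move=> i iU; have := min_estimate_le s iU.
  by rewrite -kmin lee_fin !estimate_unknown// ler_pM2l// kappa_gt0.
- move=> l lK; rewrite -estimate_known// -estimate_unknown// -lte_fin kmin.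
  by apply: lt_le_trans UK _; rewrite min_estimate_le.
- move=> i; rewrite xM; case: ifP; rewrite ?eqxx// inE => /andP[iU].
  by rewrite -kmin eqe !estimate_unknown// => /eqP/(mulfI (lt0r_neq0 kappa_gt0)) ->.
- rewrite (eq_bigr _ (fun i _ => xM i)) -big_mkcond/= sumr_const -[_ *+ _]mulr_natl divff//.
  rewrite pnatr_eq0 -lt0n; apply/card_gt0P; exists k.
  by rewrite inE kU kmin eqxx.
Qed.

Lemma slf_work_conserving : work_conserving x.
Proof.
move=> s /set0Pn[j /slf_step[[k [_ _ _ xk]]|[k _ []//]]].
by rewrite (bigD1 k)//= xk eqxx big1 ?addr0// => i /negPf ik; rewrite xk ik.
Qed.

(* Under a constant set of known jobs, the job with strictly less remaining work keeps
   its priority, so that a job behind it is not processed. *)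
Section KnownPhase.
Variables (K : {set job I}) (a b : R).
Hypotheses (a0 : 0 <= a) (ab : a <= b).
Hypothesis phase : forall w, a <= w <= b ->
  known eps x w = K /\ exists k, runs_known w k.

Lemma known_overtaken i l u v : i \in K -> a <= u -> u <= v -> v <= b ->
  remaining x i u < remaining x l u -> work x l v = work x l u.
Proof.
move=> iK au uv vb il.
(* While the work of [l] is below this value, [l] has more remaining work than [i] and is not the
   job selected. *)
apply: (@cum_start _ _ (feasible_rate l fx) _ _ (proc l - remaining x i u)) => //.
  change (work x l u < proc l - remaining x i u).
  by move: il; rewrite {2}/remaining; lra.
move=> w /andP[uw wv] lw.
have {}lw : work x l w < proc l - remaining x i u := lw.
have [|wK [k [kK kmin _ ->]]] := @phase w; first by apply/andP; split; lra.
case: eqVneq => // lk; have := kmin i; rewrite wK -lk => /(_ iK).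
have := remaining_anti i fx (ltW uw); move: lw; rewrite {4}/remaining; lra.
Qed.

(** At a density point [i] runs and [l] does not. If they were tied there, [l] would have been
    strictly ahead just before and would have blocked [i], so that no tie could arise. *)
Lemma known_ahead i l : i != l -> work x i a < work x i b ->
  exists2 w, a < w <= b & i \in K /\ (l \in K -> remaining x i w < remaining x l w).
Proof.
move=> il iwork.
have [w /andP[aw wb] [xiw H]] := rate_density (feasible_rate i fx) (feasible_rate l fx) a0 ab iwork.
exists w; first by rewrite aw.
have [|wK [k [kK kmin _ xk]]] := @phase w; first by rewrite (ltW aw).
have ik : i = k by apply/eqP; move: xiw; rewrite xk; case: eqP; rewrite ?ltxx.
rewrite -ik wK in kK kmin xk *; split=> // lK.
rewrite lt_neqAle kmin// andbT; apply/eqP => eq_il.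
have [|w' /andP[aw' w'w] lt_w'] := H; first by rewrite !xk eqxx eq_sym (negPf il) ltr01.
have ahead : remaining x l w' < remaining x i w'.
  have {}lt_w' : work x i w' - work x l w' < work x i w - work x l w := lt_w'.
  by move: eq_il; rewrite /remaining; lra.
have := known_overtaken lK aw' (ltW w'w) wb ahead.
have := remaining_anti l fx (ltW w'w); move: eq_il ahead; rewrite /remaining; lra.
Qed.

(** Ties may be broken differently at every instant. Still, if two jobs gained work, each would be
    strictly ahead of the other at some time, whereas a strict lead is never lost. *)
Lemma known_phase_single : exists j, [/\ j \in K,
  forall i, i \in K -> remaining x j a <= remaining x i a,
  forall i, i \in unknown eps x a -> remaining x j a <= kappa * work x i a &
  forall i, i != j -> work x i b = work x i a].
Proof.
have [|aK [k [kK kmin kU xk]]] := @phase a; first by rewrite lexx.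
rewrite aK in kK kmin.
have [/existsP[j jwork]|none] := boolP [exists j, work x j a < work x j b]; last first.
  exists k; split=> // i _; apply/le_anti/andP; split; last exact: work_mono.
  rewrite leNgt.
  by apply: contra none => iw; apply/existsP; exists i.
have [w0 _ [jK _]] : exists2 w, a < w <= b & j \in K /\ True.
  have [w /andP[aw wb] [xj _]] :=
    rate_density (feasible_rate j fx) (feasible_rate j fx) a0 ab jwork.
  exists w; first by rewrite aw.
  split=> //; have [|<- [k' [kK' _ _]]] := @phase w; first by rewrite (ltW aw).
  by move=> /(_ j) xE; move: xj; rewrite xE; case: eqP => [->//|]; rewrite ltxx.
have jk : remaining x j a <= remaining x k a.
  rewrite leNgt; apply/negP => kj.
  by move: jwork; rewrite (known_overtaken kK (lexx a) ab (lexx b) kj) ltxx.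
exists j; split=> // [i iK|i iU|i ij].
- exact: le_trans (kmin _ iK).
- exact: le_trans (kU _ iU).
apply/le_anti/andP; split; last exact: work_mono.
rewrite leNgt; apply/negP => iwork.
have ji : j != i by rewrite eq_sym.
have [u /andP[au ub] [iK /(_ jK) iju]] := known_ahead ij iwork.
have [v /andP[av vb] [_ /(_ iK) jiv]] := known_ahead ji jwork.
have [uv|/ltW vu] := leP u v.
  have := known_overtaken iK (ltW au) uv vb iju.
  by have := remaining_anti i fx uv; move: iju jiv; rewrite /remaining; lra.
have := known_overtaken jK (ltW av) vu ub jiv.
by have := remaining_anti j fx vu; move: iju jiv; rewrite /remaining; lra.
Qed.

End KnownPhase.

End ShortestLowerBoundFirst.

(** * The potential *)

Section Potential.
Variables (R : realType) (I : instance R) (eps : R).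
Hypotheses (eps0 : 0 < eps) (eps1 : eps < 1).
Variables x y : schedule I.
Hypotheses (slfx : is_SLF eps x) (fy : feasible y).
Implicit Types (i j k l : job I) (s u v w th : R).
Local Notation kappa := (eps / (1 - eps)).

Let fx : feasible x := slfx.1.

Hypothesis xy : forall v, total_work x v <= total_work y v.
Variables (O : {set job I}) (C : nat).
Hypothesis Ceps : eps^-1 <= C%:R.

(** The cap [proc j - th / eps] is the value of [remaining x j s - th] when the estimate
    [kappa * work x j s] equals [th]. *)
Definition phi th j s : R :=
  Num.min (Num.max (remaining x j s - th) 0) (Num.max (proc j - th / eps) 0).

(** Both sides of the invariant are merged into one summand per released job, so that arrivals and
    monotonicity can be checked job by job. *)
Definition slack th s : R := \sum_(j | release j <= s)
  (phi th j s + (if j \in O then C%:R * th - remaining y j s else 0)).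

Let volO s := \sum_(j in O | release j <= s) remaining y j s.
Let numO s := #|[set j in O | release j <= s]|.

Lemma slackE th s :
  slack th s = \sum_(j | release j <= s) phi th j s + C%:R * th * (numO s)%:R - volO s.
Proof.
rewrite /slack big_split/= -addrA; congr (_ + _).
rewrite -big_mkcondr/= (eq_bigl (fun j => j \in [set j in O | release j <= s])); last first.
  by move=> j; rewrite inE andbC.
rewrite sumrB sumr_const mulr_natr; congr (_ - _).
by apply: eq_bigl => j; rewrite inE.
Qed.

Lemma phi_ge0 th j s : 0 <= phi th j s.
Proof. by rewrite /phi le_min !le_max lexx !orbT. Qed.

Lemma phi_le th j s : phi th j s <= Num.max (remaining x j s - th) 0.
Proof. by rewrite /phi ge_min lexx. Qed.

Lemma phi_cap th j s : phi th j s <= Num.max (proc j - th / eps) 0.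
Proof. by rewrite /phi ge_min lexx orbT. Qed.

Lemma phi_eq th j s u : work x j s = work x j u -> phi th j s = phi th j u.
Proof. by rewrite /phi /remaining => ->. Qed.

Lemma phi_lip th j s u : s <= u -> phi th j s - (u - s) <= phi th j u.
Proof.
move=> su; have := remaining_lip j fx su; rewrite /phi.
set p := Num.max (proc j - _) 0; set r := remaining x j s; set r' := remaining x j u.
move=> rr'; rewrite le_min; apply/andP; split; rewrite lerBlDr ge_min; apply/orP.
  left; rewrite ge_max; apply/andP; split; last by rewrite addr_ge0 ?subr_ge0// le_max lexx orbT.
  by rewrite -lerBlDr le_max; apply/orP; left; lra.
by right; lra.
Qed.

Lemma level_divK th : th / eps * eps = th.
Proof. by rewrite mulfVK// lt0r_neq0. Qed.

(** The cap does not bind: [eps] times it is [eps * proc j - th], which is at least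
    [remaining x j s - th], and [eps < 1]. *)
Lemma phi_known th j s : j \in known eps x s -> remaining x j s - th <= phi th j s.
Proof.
rewrite inE => /andP[jA jK].
rewrite /phi le_min !le_max lexx/=.
have [|r0] := leP (remaining x j s - th) 0; first by rewrite orbT.
have E : eps * (proc j - th / eps) = eps * proc j - th.
  by rewrite mulrBr mulrCA mulfV ?mulr1// gt_eqF.
have m0 : 0 < proc j - th / eps by rewrite -(pmulr_rgt0 _ eps0) E; lra.
have : eps * (proc j - th / eps) <= proc j - th / eps by rewrite ger_pMl// ltW.
by rewrite orbF E; lra.
Qed.

Lemma unknown_estimate_le j s : j \in unknown eps x s ->
  kappa * work x j s <= remaining x j s.
Proof.
rewrite !inE => /andP[+ jA]; rewrite jA/= -ltNge => jU.
have e1 : 0 < 1 - eps by rewrite subr_gt0.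
rewrite mulrAC ler_pdivrMr//; move: jU; rewrite /remaining; have := proc_gt0 j; nra.
Qed.

(** An estimate of at least [th] means work of at least [th / eps * (1 - eps)], from where on the
    cap does not bind. Up to that amount of work it does, by [phi_capped]. *)
Lemma phi_unknown_le th j s : j \in unknown eps x s -> th <= kappa * work x j s ->
  remaining x j s - th <= phi th j s.
Proof.
rewrite !inE => /andP[+ jA]; rewrite jA/= -ltNge => jU thw.
rewrite /phi le_min !le_max lexx/=; apply/orP; left.
have e1 : 1 - eps != 0 by rewrite gt_eqF// subr_gt0.
have := level_divK th; set q := th / eps => qE.
have : q * (1 - eps) <= work x j s.
  rewrite -(ler_pM2l eps0) mulrA [eps * q]mulrC qE -ler_pdivlMr ?subr_gt0//.
  by rewrite mulrAC.
by rewrite /remaining; lra.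
Qed.

Lemma phi_capped th j s : work x j s <= th / eps * (1 - eps) ->
  phi th j s = Num.max (proc j - th / eps) 0.
Proof.
move=> wth; rewrite /phi min_r//.
have E : th / eps - th / eps * (1 - eps) = th by rewrite -[RHS]level_divK; ring.
rewrite ge_max !le_max lexx orbT andbT; apply/orP; left.
by rewrite /remaining; lra.
Qed.

Lemma sum_phi_ge th s (D : {set job I}) : D \subset active x s ->
  (forall j, j \in D -> remaining x j s - th <= phi th j s) ->
  \sum_(j in D) remaining x j s - #|D|%:R * th <= \sum_(j | release j <= s) phi th j s.
Proof.
move=> /fintype.subsetP DA Dphi; rewrite mulr_natl -sumr_const -sumrB.
apply: le_trans (ler_sum _ Dphi) _.
rewrite [leRHS](bigID (fun j => j \in D))/= (eq_bigl (fun j => (release j <= s) && (j \in D))).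
  by rewrite lerDl sumr_ge0// => j _; exact: phi_ge0.
by move=> j; case: (boolP (j \in D)) => [/DA/active_release ->|]; rewrite ?andbF.
Qed.

(** The level separates [D] from the other active jobs, so potentials outside [D] vanish; this is
    the dual form of the sum of the [#|D|] largest remaining times. *)
Lemma sum_phi_le th s (D : {set job I}) : 0 <= th -> D \subset active x s ->
  (forall j, j \in D -> th <= remaining x j s) ->
  (forall j, j \in active x s :\: D -> remaining x j s <= th) ->
  \sum_(j | release j <= s) phi th j s <= \sum_(j in D) remaining x j s - #|D|%:R * th.
Proof.
move=> th0 /fintype.subsetP DA Dge Dle; rewrite mulr_natl -sumr_const -sumrB.
rewrite (bigID (fun j => j \in D))/= addrC big1 ?add0r; last first.
  move=> j /andP[js jD]; apply/le_anti; rewrite phi_ge0 andbT.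
  apply: le_trans (phi_le th j s) _; rewrite ge_max lexx andbT subr_le0.
  have [jA|jA] := boolP (j \in active x s); first by apply: Dle; rewrite inE jD.
  by rewrite (inactive_remaining fx js jA).
rewrite (eq_bigl (fun j => j \in D)); last first.
  by move=> j; case: (boolP (j \in D)) => [/DA/active_release ->|]; rewrite ?andbF.
apply: ler_sum => j jD; apply: le_trans (phi_le th j s) _.
by rewrite ge_max lexx subr_ge0 Dge.
Qed.

Lemma volO_anti s u : s <= u -> (forall j, (release j <= u) = (release j <= s)) ->
  volO u <= volO s.
Proof.
move=> su relE; rewrite /volO; under eq_bigl do rewrite relE.
by apply: ler_sum => j _; exact: remaining_anti.
Qed.

Lemma active_volume s : volO s <= \sum_(j in active x s) remaining x j s.
Proof.
apply: (@le_trans _ _ (\sum_(j | release j <= s) remaining y j s)).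
  rewrite /volO big_mkcond/= [leRHS]big_mkcond/=; apply: ler_sum => j _.
  by case: (j \in O) => //=; case: ifP => // _; exact: remaining_ge0.
rewrite sum_remaining_released//.
apply: (@le_trans _ _ (\sum_(j | release j <= s) remaining x j s)).
  by rewrite sum_remaining_released// lerD2l lerN2.
rewrite (bigID (fun j => j \in active x s))/= addrC big1 ?add0r; last first.
  by move=> j /andP[js jA]; exact: inactive_remaining.
rewrite (eq_bigl (fun j => j \in active x s))//.
by move=> j; case: (boolP (j \in active x s)) => [/active_release ->|]; rewrite ?andbF.
Qed.

Lemma slack_few th s : 0 <= th -> (#|active x s| <= C * numO s)%N ->
  (forall j, j \in active x s -> remaining x j s - th <= phi th j s) -> 0 <= slack th s.
Proof.
move=> th0 few Aphi; rewrite slackE.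
have := sum_phi_ge (subxx _) Aphi; have := active_volume s.
have : #|active x s|%:R * th <= (C * numO s)%:R * th by rewrite ler_wpM2r// ler_nat.
rewrite natrM; nra.
Qed.

(** Going down from [th'] to [th] gains [th' - th] on every job of [D] and loses it [C * numO s]
    times, which is no more often. *)
Lemma slack_many th th' s u (D : {set job I}) : 0 <= th -> th <= th' ->
  s <= u -> (forall j, (release j <= u) = (release j <= s)) ->
  (C * numO s <= #|D|)%N -> D \subset active x s -> D \subset active x u ->
  (forall j, j \in D -> remaining x j u = remaining x j s) ->
  (forall j, j \in D -> th' <= remaining x j s) ->
  (forall j, j \in active x s :\: D -> remaining x j s <= th') ->
  (forall j, j \in D -> remaining x j u - th <= phi th j u) ->
  0 <= slack th' s -> 0 <= slack th u.
Proof.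
move=> th0 thth su relE many Ds Du rD Dge Dle Dphi; rewrite !slackE.
have := sum_phi_le (le_trans th0 thth) Ds Dge Dle.
have := sum_phi_ge Du Dphi; rewrite (eq_bigr _ rD).
have -> : numO u = numO s by apply: eq_card => j; rewrite !inE relE.
have := volO_anti su relE.
have : (C * numO s)%:R * (th' - th) <= #|D|%:R * (th' - th).
  by rewrite ler_wpM2r ?ler_nat// subr_ge0.
rewrite natrM; nra.
Qed.

Lemma slack_mono th s u : s <= u -> (forall j, (release j <= u) = (release j <= s)) ->
  (forall j, phi th j s <= phi th j u) -> slack th s <= slack th u.
Proof.
move=> su relE H; rewrite /slack [leRHS](eq_bigl _ _ relE); apply: ler_sum => j _.
by rewrite lerD//; case: ifP => // _; rewrite lerB// remaining_anti.
Qed.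

(** * Propagation of the invariant in time *)

Lemma slack_arrivals v : 0 <= v -> (forall u, u < v -> forall th, 0 <= th -> 0 <= slack th u) ->
  forall th, 0 <= th -> 0 <= slack th v.
Proof.
move=> v0 IH th th0; rewrite leNgt; apply/negP => neg.
have [|d d0 dE] := @exists_delta _ _ [pred j : job I | release j < v] (fun j => v - release j).
  by move=> j; rewrite subr_gt0.
pose n := #|job I|%:R : R; have n0 : 0 <= n by rewrite ler0n.
have n1 : 0 < n + 1 by rewrite ltr_wpDl.
(* With [e <= d] no job is released strictly between [v - e] and [v]; the other bound keeps the
   loss, at most [e] per job, below the supposed deficit. *)
pose e := Num.min d (- slack th v / (n + 1)).
have e0 : 0 < e by rewrite lt_min d0 divr_gt0// oppr_gt0.
have ed : e <= d by rewrite ge_min lexx.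
have en : n * e < - slack th v.
  apply: (@lt_le_trans _ _ ((n + 1) * e)); first by rewrite ltr_pM2r// ltrDl.
  by rewrite mulrC -ler_pdivlMr// ge_min lexx orbT.
have uv : v - e < v by rewrite ltrBlDr ltrDl.
have := IH _ uv th th0.
suff : slack th (v - e) - n * e <= slack th v by lra.
rewrite /slack [X in X - _ <= _]big_mkcond [leRHS]big_mkcond/=.
have -> : n * e = \sum_(j : job I) e by rewrite sumr_const mulr_natl.
rewrite -sumrB; apply: ler_sum => j _.
have [ju|ju] := leP (release j) (v - e).
  rewrite (le_trans ju (ltW uv)).
  have := phi_lip th j (ltW uv); have := remaining_anti j fy (ltW uv).
  by case: ifP; lra.
have jv : v <= release j.
  by rewrite leNgt; apply/negP => jv; have := dE j jv; lra.
case: ifP => [j_v|_]; last by lra.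
have wx : work x j v = 0 by exact: work_unreleased.
have wy : work y j v = 0 by exact: work_unreleased.
have : 0 <= th / eps by rewrite divr_ge0// ltW.
have Cth : th / eps <= C%:R * th by rewrite mulrC ler_wpM2r.
move=> q0; have -> : phi th j v = Num.max (proc j - th / eps) 0.
  by apply: phi_capped; rewrite wx mulr_ge0// subr_ge0 ltW.
rewrite /remaining wy subr0.
have p_le : proc j - th / eps <= Num.max (proc j - th / eps) 0 by rewrite le_max lexx.
have ge0 : 0 <= Num.max (proc j - th / eps) 0 by rewrite le_max lexx orbT.
by case: ifP; lra.
Qed.

Lemma slack_unknown_phase v w : 0 <= v -> v <= w ->
  (forall u, v <= u <= w -> [/\ forall j, (release j <= u) = (release j <= v),
     active x u = active x v, known eps x u = known eps x v & runs_unknown eps x u]) ->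
  (forall th, 0 <= th -> 0 <= slack th v) -> forall th, 0 <= th -> 0 <= slack th w.
Proof.
move=> v0 vw phase IH.
have [|relE actE knE [k0 k0U [kmin kK krun _]]] := @phase w; first by rewrite vw lexx.
(* The minimal estimate at the end of the phase. It bounds the minimum throughout, since [k0] stays
   unknown and its work only grows. *)
pose h := kappa * work x k0 w.
have k0' : 0 < kappa by exact: kappa_gt0.
have h0 : 0 <= h by rewrite mulr_ge0 ?work_ge0// ltW.
have above th : h <= th -> 0 <= slack th w.
  move=> hth; have th0 := le_trans h0 hth.
  apply: le_trans (IH th th0) _; apply: slack_mono => // j.
  (* A job is processed only while its estimate is at most [h <= th]. So either it gained no work,
     or its potential still equals the cap. *)
  have : work x j w <= Num.max (work x j v) (th / eps * (1 - eps)).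
    apply: cum_stop => //; first exact: feasible_rate.
    move=> u /andP[vu uw] ju; apply: contrapT => /eqP xju.
    have {}ju : th / eps * (1 - eps) < work x j u := ju.
    have [|relu actu knu [k kU [ku _ kr _]]] := @phase u; first by rewrite (ltW vu).
    have k0u : k0 \in unknown eps x u by rewrite /unknown actu knu -actE -knE.
    move: ju; apply/negP; rewrite -leNgt.
    apply: le_trans (kr _ xju) _; apply: le_trans (ku _ k0u) _.
    apply: le_trans (work_mono k0 fx uw) _.
    have e1 : 0 < 1 - eps by rewrite subr_gt0.
    have : h / eps * (1 - eps) <= th / eps * (1 - eps).
      by rewrite ler_pM2r// ler_pM2r ?invr_gt0.
    apply: le_trans; rewrite /h [X in _ <= X](_ : _ = work x k0 w)//.
    by field; rewrite !gt_eqF.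
  rewrite le_max => /orP[jw|jw].
    rewrite (@phi_eq _ _ v w)//; apply/le_anti; rewrite jw andbT work_mono//.
  by rewrite (phi_capped jw); exact: phi_cap.
move=> th th0; have [|hth] := leP h th; first exact: above.
have est j : j \in active x w -> h <= remaining x j w /\ remaining x j w - th <= phi th j w.
  move=> jA; have [jK|jK] := boolP (j \in known eps x w).
    by split; [exact/ltW/kK|exact: phi_known].
  have jU : j \in unknown eps x w by rewrite inE jK.
  have hj : h <= kappa * work x j w by rewrite ler_pM2l// kmin.
  split; last exact: phi_unknown_le (le_trans (ltW hth) hj).
  exact: le_trans hj (unknown_estimate_le jU).
have [few|many] := leqP #|active x w| (C * numO w).
  by apply: slack_few => // j /est[].
(* Time stays at [w]; only the level is lowered from [h], which bounds all remaining times from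
   below. *)
apply: (@slack_many th h w w (active x w)) => //; first exact: ltW.
- exact: ltnW.
- by move=> j /est[].
- by move=> j; rewrite finset.setDv inE.
- by move=> j /est[].
- exact: above.
Qed.

Lemma slack_known_phase v w : 0 <= v -> v <= w ->
  (forall u, v <= u <= w -> [/\ forall j, (release j <= u) = (release j <= v),
     active x u = active x v, known eps x u = known eps x v & exists k, runs_known eps x u k]) ->
  (forall th, 0 <= th -> 0 <= slack th v) -> forall th, 0 <= th -> 0 <= slack th w.
Proof.
move=> v0 vw phase IH th th0.
have [|relE actE knE _] := @phase w; first by rewrite vw lexx.
have [|j [jK jmin jU jother]] :=
    @known_phase_single _ _ _ _ slfx (known eps x v) v w v0 vw.
  by move=> u /phase[].
have jA := known_active jK.
(* At levels from [remaining x j v] on, the potential of [j] is already zero, and no other job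
   changes. *)
have [hth|/ltW thh] := leP (remaining x j v) th.
  apply: le_trans (IH th th0) _; apply: slack_mono => // i.
  have [->|ij] := eqVneq i j; last by rewrite (phi_eq th (jother i ij)).
  apply: le_trans (phi_ge0 _ _ _); apply: le_trans (phi_le _ _ _) _.
  by rewrite ge_max lexx andbT subr_le0.
have est i : i \in active x v -> i != j -> remaining x j v <= remaining x i v /\
    remaining x i v - th <= phi th i v.
  move=> iA ij; have [iK|iK] := boolP (i \in known eps x v).
    by split; [exact: jmin|exact: phi_known].
  have iU : i \in unknown eps x v by rewrite inE iK.
  have := jU i iU => hj; split; last exact: phi_unknown_le (le_trans thh hj).
  exact: le_trans hj (unknown_estimate_le iU).
have rE i : i != j -> remaining x i w = remaining x i v by move=> ij; rewrite /remaining jother.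
have [few|many] := leqP #|active x w| (C * numO w).
  apply: slack_few => // i; rewrite actE => iA.
  have [->|ij] := eqVneq i j; first by apply: phi_known; rewrite knE.
  by rewrite rE// (phi_eq th (jother i ij)); have [] := est i iA ij.
have numE : numO w = numO v by apply: eq_card => i; rewrite !inE relE.
(* More than [C * numO w] jobs are active, so at least that many remain without [j]; their remaining
   times are unchanged and at least that of [j] at [v]. *)
apply: (@slack_many th (remaining x j v) v w (active x v :\ j)) => //.
- by move: many; rewrite -numE actE (cardsD1 j (active x v)) jA.
- exact: subsetDl.
- by rewrite actE; exact: subsetDl.
- by move=> i; rewrite !inE => /andP[ij _]; exact: rE.
- by move=> i /setD1P[ij iA]; have [] := est i iA ij.
- move=> i; rewrite finset.in_setD in_setD1 negb_and negbK => /andP[/orP[/eqP ->//|iA]].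
  by rewrite (negPf iA).
- move=> i /setD1P[ij iA]; rewrite rE// (phi_eq th (jother i ij)).
  by have [] := est i iA ij.
- by apply: IH; exact: remaining_ge0.
Qed.

Lemma slack_right v : 0 <= v -> (forall th, 0 <= th -> 0 <= slack th v) ->
  exists2 d, 0 < d & forall w, v < w <= v + d -> forall th, 0 <= th -> 0 <= slack th w.
Proof.
move=> v0 IH; have [d d0 stable] := stable_window eps v fx.
have unkE u : v <= u <= v + d -> unknown eps x u = unknown eps x v.
  by move=> /stable[_ aE kE]; rewrite /unknown aE kE.
have [A0|[j jA]] := set_0Vmem (active x v).
  exists d => // w /andP[/ltW vw wd] th th0; apply: slack_few => //.
    by have [|_ -> _] := stable w; rewrite ?vw// A0 cards0.
  by move=> j; have [|_ -> _] := stable w; rewrite ?vw// A0 inE.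
have [[k [kK kmin kU _]]|[k kU [kmin kK _ _]]] := slf_step eps0 eps1 slfx jA.
  exists d => // w /andP[/ltW vw wd]; apply: slack_known_phase v0 vw _ IH.
  move=> u /andP[vu uw]; have vud : v <= u <= v + d by rewrite vu (le_trans uw).
  have [relE actE knE] := stable u vud; split=> //.
  (* The known case persists: the remaining time of [k] only falls, and the estimates of unknown
     jobs only rise. *)
  have := jA; rewrite -actE => /(slf_step eps0 eps1 slfx)[//|[i iU [_ iK _ _]]].
  have := iK k; rewrite knE => /(_ kK).
  have := kU i; rewrite -(unkE u vud) => /(_ iU).
  have := remaining_anti k fx vu.
  have : kappa * work x i v <= kappa * work x i u by rewrite ler_pM2l ?kappa_gt0// work_mono.
  by lra.
have k0 : 0 < kappa by exact: kappa_gt0.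
(* A known job's remaining time falls at rate at most 1 and the estimate of [k] rises at rate at
   most [kappa]; hence the divisor [1 + kappa] for the time during which the gap cannot close. *)
have [|d' d'0 gap] := @exists_delta _ _ [pred l | l \in known eps x v]
    (fun l => (remaining x l v - kappa * work x k v) / (1 + kappa)).
  by move=> l /kK ?; rewrite divr_gt0 ?subr_gt0// ltr_wpDr// ltW.
exists (Num.min d d'); first by rewrite lt_min d0.
move=> w /andP[/ltW vw]; rewrite -lerBlDl le_min => /andP[wd wd'].
apply: slack_unknown_phase v0 vw _ IH.
move=> u /andP[vu uw]; have vud : v <= u <= v + d by rewrite vu/=; lra.
have [relE actE knE] := stable u vud; split=> //.
have := jA; rewrite -actE => /(slf_step eps0 eps1 slfx)[[i [iK imin iU _]]|//].
rewrite knE in iK.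
have := iU k; rewrite (unkE u vud) => /(_ kU).
have c1 : 0 < 1 + kappa by rewrite ltr_wpDr// ltW.
have := gap i iK; rewrite ltr_pdivlMr//.
have ri := remaining_lip i fx vu.
have ek : kappa * (work x k u - work x k v) <= kappa * (u - v) by rewrite ler_pM2l// work_lip.
have : (1 + kappa) * (u - v) <= (1 + kappa) * d' by rewrite ler_pM2l//; lra.
by move: ri ek; set q := kappa; lra.
Qed.

Lemma slack_nonneg v th : 0 <= th -> 0 <= slack th v.
Proof.
move: v th; apply: real_induction => [v v0 th th0|v v0|v v0]; last 2 first.
- exact: slack_arrivals.
- exact: slack_right.
rewrite /slack big_pred0// => j; apply/negbTE; rewrite -ltNge.
exact: lt_le_trans v0 (release_ge0 j).
Qed.

Lemma largest_remaining_volume s (B : {set job I}) :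
  (forall j, j \in O -> release j <= s) -> largest_remaining x s (C * #|O|) B ->
  \sum_(j in O) remaining y j s <= \sum_(j in B) remaining x j s.
Proof.
move=> Os [BA Bcard Bmax].
have volE : \sum_(j in O) remaining y j s = volO s.
  by apply: eq_bigl => j; case: (boolP (j \in O)) => //= /Os ->.
have numE : numO s = #|O|.
  by apply: eq_card => j; rewrite inE; case: (boolP (j \in O)) => //= /Os ->.
rewrite volE; have [few|many] := leqP #|active x s| (C * #|O|).
  suff -> : B = active x s by exact: active_volume.
  by apply/eqP; rewrite eqEcard BA Bcard (minn_idPr few) leqnn.
have {}Bcard : #|B| = (C * #|O|)%N by rewrite Bcard (minn_idPl (ltnW many)).
have [D0|[j0 j0D]] := set_0Vmem (active x s :\: B).
  by move: many; rewrite -Bcard ltnNge subset_leq_card// -finset.setD_eq0 D0.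
(* This level separates [B] from the other active jobs. As [#|B|] is [C * #|O|], the level terms of
   the invariant and of [sum_phi_le] cancel. *)
case: (arg_maxP (fun j => remaining x j s) j0D) => j jD jmax.
have th0 : 0 <= remaining x j s by exact: remaining_ge0.
have := slack_nonneg s th0; rewrite slackE numE.
have := sum_phi_le th0 BA (fun i iB => Bmax i j iB jD) jmax.
rewrite Bcard natrM; lra.
Qed.

End Potential.

Theorem lemma3p2 (R : realType) (eps : R) (heps0 : 0 < eps) (heps1 : eps < 1)
  (I : instance R) (slf opt : schedule I)
  (hslf : is_SLF eps slf) (hopt : optimal opt)
  (t t' : R) (htt' : t' <= t) (B : {set job I})
  (hB : largest_remaining slf t'
          (`|Num.ceil eps^-1| * #|active opt t :&: active opt t'|)%N B) :
  total_remaining opt (active opt t :&: active opt t') t'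
    <= total_remaining slf B t'.
Proof.
have wc := slf_work_conserving heps0 heps1 hslf.
have workle v : total_work slf v <= total_work opt v.
  exact: optimal_total_work hslf.1 wc hopt.
have Ceps : eps^-1 <= `|Num.ceil eps^-1|%N%:R.
  have einv : 0 < eps^-1 by rewrite invr_gt0.
  (* The ceiling is nonnegative, so its absolute value as a natural number is the ceiling itself. *)
  by rewrite natr_absz ger0_norm ?ceil_ge// ceil_ge0 (lt_trans (ltrN10 R)).
apply: (largest_remaining_volume heps0 heps1 hslf hopt.1 workle Ceps _ hB) => j.
by rewrite finset.in_setI => /andP[_ /active_release].
Qed.
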